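(* For each $n$, let $K_n$ be the complete graph on the vertex set $V=\{1,2,\ldots,n\}$, let $p(f)=p_n(f)\in[0,1]$ for each edge $f$ of $K_n$, let $X_f$, $f\in K_n$, be independent Bernoulli random variables with $\mathbb{P}(X_f=1)=p(f)=1-\mathbb{P}(X_f=0)$, and let $G$ be the random subgraph of $K_n$ on $V$ formed by all edges $f$ with $X_f=1$. Let $\{w(h)\}_{h\in K_n}$ be i.i.d. edge weights, independent of $G$, with constant mean $1\le\mu_0<\infty$ and satisfying $w(h)\ge 1$ almost surely for all edges $h$. Suppose $\mathbb{E}w^{2s}(u,v)<\infty$ for some integer $s\ge 1$. (a) Suppose that for each vertex $u$ the average edge probability $p_{av}(u):=\frac{1}{n-1}\sum_{v\ne u}p(u,v)$ satisfies $\frac{C_1}{n^{\beta}}\le p_{av}(u)\le\frac{C_2}{n^{\beta}}$ for some positive constants $C_1,C_2$ and $0<\beta<1$. If $s>\frac{1}{1-\beta}$, then there is a constant $C>0$ such that $$\mathbb{P}\left(E_{good}(C,1-\beta,s(1-\beta)-1)\right)\ge 1-e^{-C^{-1}n^{1-\beta}}.$$ (b) Suppose that the average edge probability $p_{av}:=\binom{n}{2}^{-1}\sum_{h}p(h)$ (sum over all edges $h$ of $K_n$) satisfies $\frac{C_1}{n^{\beta}}\le p_{av}\le\frac{C_2}{n^{\beta}}$ for some positive constants $C_1,C_2$ and some $\frac{2}{s}<\beta<1$. For every $0<\gamma<\frac{\beta}{2}-\frac{1}{s}$, there is a constant $D>0$ such that $$\mathbb{P}\left(E_{good}(D,1-\gamma,\beta)\right)\ge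 1-e^{-D^{-1}n^{2-\beta}}.$$
   Context: Weighted colouring number: for a graph $H=(V,E)$ with edge weights $w(u,v)\ge 1$, a map $f:V\to\{1,2,\ldots\}$ is a proper weighted colouring of $H$ if $|f(u)-f(v)|\ge w(u,v)$ for every edge $(u,v)\in E$. The weighted colouring number of $H$ is $$\chi_w(H):=\min_f\max_{(u,v)\in E}|f(u)-f(v)|,$$ where the minimum is over all proper weighted colourings $f$ of $H$. Good event: for a realization $\omega$ of the random graph $G$, $\mathbb{P}_\omega$ denotes the probability measure associated with the (random) edge weights of $\omega$. For constants $C,\epsilon_1,\epsilon_2>0$, $$E_{good}(C,\epsilon_1,\epsilon_2):=\left\{\omega:\ \mathbb{P}_\omega\left(\chi_w(\omega)\le C n^{\epsilon_1}\right)\ge 1-\frac{C}{n^{\epsilon_2}}\right\},$$ which is an event in terms of $G$. Constants do not depend on $n$. *)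

(* Defs.v *)
From HB Require Import structures.
From mathcomp Require Import all_boot all_order all_algebra.
From mathcomp Require Import all_classical all_reals all_analysis.

Set Implicit Arguments.
Unset Strict Implicit.
Unset Printing Implicit Defensive.

Import Order.TTheory GRing.Theory Num.Theory.
Import numFieldNormedType.Exports.

Local Open Scope classical_set_scope.
Local Open Scope ring_scope.

Definition edge n (u v : 'I_n) : {set 'I_n} := [set u; v]%SET.

(* A graph on 'I_n is given by its set of edges, a subset of K n. *)
Definition K n : {set {set 'I_n}} := [set e : {set 'I_n} | #|e| == 2%N]%SET.

Section Colouring.
Context {R : realType} {n : nat}.
Implicit Types (H : {set {set 'I_n}}) (wt : {set 'I_n} -> R) (f : 'I_n -> nat).

Definition proper_wcolouring H wt f : Prop :=
  (forall u, (0 < f u)%N) /\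
  (forall u v, edge u v \in H -> wt (edge u v) <= `|(f u)%:R - (f v)%:R|).

(* The maximum is 0 when the graph has no edge. *)
Definition spread H f : nat :=
  \max_(e : 'I_n * 'I_n | edge e.1 e.2 \in H) `|f e.1 - f e.2|%N.

(* The infimum is a minimum: see chi_w_min below. *)
Definition chi_w H wt : R :=
  inf [set (spread H f)%:R | f in proper_wcolouring H wt].

Lemma edge_K u v : (edge u v \in K n) = (u != v).
Proof. by rewrite inE cards2; case: (u != v). Qed.

Lemma proper_wcolouring_exists H wt : H \subset K n ->
  exists f, proper_wcolouring H wt f.
Proof.
move=> /fintype.subsetP HK.
pose M : nat := \max_(e : {set 'I_n}) Num.bound (wt e).
have wtM e : wt e <= M%:R.
  apply: (le_trans (ler_norm _)); apply: ltW.
  apply: (lt_le_trans (archi_boundP (normr_ge0 _))).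
  by rewrite ler_nat; apply: leq_trans (leq_bigmax e); rewrite /Num.bound normr_id.
exists (fun u : 'I_n => (u * M).+1); split=> // u v /HK; rewrite edge_K => uv.
apply: (le_trans (wtM _)).
wlog lt_uv : u v uv / (u < v)%N => [W|].
  have [/W|/W|/val_inj/eqP] := ltngtP u v; last by rewrite (negbTE uv).
    exact.
  by rewrite distrC eq_sym => /(_ uv).
rewrite distrC -natrB ?ltnS ?leq_mul2r ?(ltnW lt_uv) ?orbT//.
by rewrite subSS -mulnBl normr_nat ler_nat leq_pmull// subn_gt0.
Qed.

Lemma chi_w_min H wt : H \subset K n ->
  exists f, [/\ proper_wcolouring H wt f, chi_w H wt = (spread H f)%:R &
    forall g, proper_wcolouring H wt g -> (spread H f <= spread H g)%N].
Proof.
move=> /(@proper_wcolouring_exists _ wt)[f0 pf0].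
pose Q := [pred k | `[< exists2 f, proper_wcolouring H wt f & spread H f = k >]].
have exQ : exists k, Q k by exists (spread H f0); apply/asboolP; exists f0.
case: (ex_minnP exQ) => k /asboolP[f pf <-] kmin.
have fmin g : proper_wcolouring H wt g -> (spread H f <= spread H g)%N.
  by move=> pg; apply: kmin; apply/asboolP; exists g.
exists f; split=> //; apply/eqP; rewrite eq_le; apply/andP; split.
  by apply: ge_inf; [exists 0 => _ [g _ <-] | exists f].
apply: lb_le_inf; first by exists (spread H f)%:R, f.
by move=> _ [g pg <-]; rewrite ler_nat fmin.
Qed.

End Colouring.

Section Probability.
Context {R : realType} {d : measure_display} {T : measurableType d}.
Variable P : probability T R.

Definition mutually_independent {d'} {T' : measurableType d'} {I : finType}
    (D : {set I}) (X : I -> {RV P >-> T'}) : Prop :=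
  forall (J : {set I}) (B : I -> set T'), J \subset D ->
    (forall i, measurable (B i)) ->
    P (\bigcap_(i in [set` J]) X i @^-1` B i) =
      (\prod_(i in J) P (X i @^-1` B i))%E.

Definition sigma_RVs {d'} {T' : measurableType d'} {I : finType}
    (D : {set I}) (X : I -> {RV P >-> T'}) : set (set T) :=
  <<s \bigcup_(i in [set` D]) preimage_set_system setT (X i) measurable >>.

Definition bernoulli_RV (X : {RV P >-> R}) (q : R) : Prop :=
  P [set x | X x = 1] = q%:E /\ P [set x | X x = 0] = (1 - q)%:E.

Definition random_graph n (X : {set 'I_n} -> {RV P >-> R}) (x : T) :
    {set {set 'I_n}} :=
  [set e in K n | X e x == 1]%SET.

Definition graph_indep_weights n (X w : {set 'I_n} -> {RV P >-> R}) : Prop :=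
  forall (S : set {set {set 'I_n}}) (B : set T), sigma_RVs (K n) w B ->
    P (random_graph X @^-1` S `&` B) = (P (random_graph X @^-1` S) * P B)%E.

(* The realization of the graph is frozen at x, and the inner probability is
   taken over the weights only (variable y). *)
Definition E_good n (X w : {set 'I_n} -> {RV P >-> R}) (C eps1 eps2 : R) :
    set T :=
  [set x | (P [set y | (chi_w (random_graph X x) (fun e => w e y)
                        <= C * n%:R `^ eps1)%R]
            >= (1 - C / n%:R `^ eps2)%:E)%E].

End Probability.

Section Averages.
Context {R : realType} {n : nat}.

Definition p_av_at (p : {set 'I_n} -> R) (u : 'I_n) : R :=
  (n.-1)%:R^-1 * \sum_(v | v != u) p (edge u v).

Definition p_av (p : {set 'I_n} -> R) : R :=
  ('C(n, 2))%:R^-1 * \sum_(h in K n) p h.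

End Averages.

(* Main.v *)
Require Import Defs.
From mathcomp Require Import all_boot all_order all_algebra.
From mathcomp Require Import all_classical all_reals all_analysis.
From mathcomp Require Import measurable_realfun.
From mathcomp Require Import zify ring lra.

(* Colour the vertices greedily along a fixed ordering: the weights towards the
   earlier neighbours of u forbid at most the sum of (2 * w + 1) over these
   neighbours, so chi_w is at most the largest such sum.  If every vertex has at
   most m earlier neighbours, a Chernoff bound for the weights truncated at
   m / (3 * s), together with Markov's inequality for the 2s-th moment above the
   truncation level, shows that a given sum exceeds a constant times m with
   probability O(m ^ -s); a union bound over the vertices follows.  In (a) any
   ordering works with m of order n ^ (1 - beta), since by Chernoff all degrees
   are of that order.  In (b) Chernoff bounds the number of edges by
   O(n ^ (2 - beta)); ordering the vertices by decreasing degree, a vertex with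
   k earlier neighbours forces k ^ 2 <= 2 * #|edges|, so m can be taken of order
   n ^ (1 - gamma), which is larger than n ^ (1 - beta / 2). *)

Set Implicit Arguments.
Unset Strict Implicit.
Unset Printing Implicit Defensive.

Import Order.TTheory GRing.Theory Num.Theory.
Import numFieldNormedType.Exports.

Local Open Scope classical_set_scope.
Local Open Scope ring_scope.

(** * Expectation of a product of functions of independent variables *)

Section ProductExpectation.
Local Open Scope ereal_scope.
Context {R : realType} {d : measure_display} {T : measurableType d}.
Variable P : probability T R.
Import HBNNSimple.

(** Linearity carries the identity from indicators to simple functions, and monotone convergence to
    every nonnegative measurable [f]. Finiteness of [c] makes multiplication by it continuous in the
    extended reals. *)
Lemma integral_mul_of_indic (U : {RV P >-> R}) (Z : T -> R) (c : \bar R)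
    (f : R -> R) :
  measurable_fun setT Z -> (forall x, 0 <= Z x)%R -> c \is a fin_num ->
  measurable_fun setT f -> (forall y, 0 <= f y)%R ->
  (forall A : set R, measurable A ->
     \int[P]_x (\1_A (U x) * Z x)%:E = P (U @^-1` A) * c) ->
  \int[P]_x (f (U x) * Z x)%:E = (\int[P]_x (f (U x))%:E) * c.
Proof.
move=> mZ Z0 cfin mf f0 H.
have mEf : measurable_fun [set: R] (fun y : R => (f y)%:E).
  exact/measurable_EFinP.
have Ef0 (y : R) : setT y -> 0 <= (f y)%:E by rewrite lee_fin.
pose g := nnsfun_approx measurableT mEf.
have mgU n : measurable_fun setT (fun x => g n (U x)).
  exact: measurableT_comp.
have g0 n y : (0 <= g n y)%R by exact: fun_ge0.
have ndg y m n : (m <= n)%N -> (g m y <= g n y)%R.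
  by move=> mn; exact/lefP/nd_nnsfun_approx.
have cvgg y : (g n y)%:E @[n --> \oo] --> (f y)%:E.
  exact: (cvg_nnsfun_approx measurableT mEf).
have gE n : \int[P]_x (g n (U x) * Z x)%:E = (\int[P]_x (g n (U x))%:E) * c.
  have mA r : measurable (g n @^-1` [set r]) by exact: measurable_sfunP.
  have mI r : measurable_fun setT (fun x => \1_(g n @^-1` [set r]) (U x) : R).
    by apply: (measurableT_comp (measurable_indic _)).
  have neg r : (r < 0)%R -> g n @^-1` [set r] = set0 by exact: preimage_nnfun0.
  (* Decomposition along the level sets of [g n], used for [W = Z] and for [W = 1]; negative levels
     have empty preimage and contribute 0. *)
  have sumE (W : T -> R) : measurable_fun setT W -> (forall x, 0 <= W x)%R ->
      \int[P]_x (g n (U x) * W x)%:E = \sum_(r \in range (g n))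
        r%:E * \int[P]_x (\1_(g n @^-1` [set r]) (U x) * W x)%:E.
    move=> mW W0.
    have ge0 r x : 0 <= r%:E * (\1_(g n @^-1` [set r]) (U x) * W x)%:E.
      by rewrite EFinM muleA mule_ge0 ?lee_fin//; exact: nnfun_muleindic_ge0.
    transitivity (\int[P]_x \sum_(r \in range (g n))
        (r%:E * (\1_(g n @^-1` [set r]) (U x) * W x)%:E)).
      apply: eq_integral => x _; rewrite fimfunE mulr_fsuml -fsumEFin//.
      by apply: eq_fsbigr => r _; rewrite -EFinM mulrA.
    rewrite ge0_integral_fsum//; last first.
      by move=> r; apply/measurable_EFinP; do 2 apply: measurable_funM => //.
    apply: eq_fsbigr => r _; have [r0|r0] := leP 0%R r.
      rewrite ge0_integralZl//; last by move=> x _; rewrite lee_fin mulr_ge0.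
      by apply/measurable_EFinP; apply: measurable_funM.
    rewrite neg// !integral0_eq ?mule0// => x _; rewrite indic0 mul0r//.
    by rewrite mule0.
  rewrite sumE//; under eq_fsbigr do rewrite H// muleA.
  under [in RHS]eq_integral do rewrite -[g n _]mulr1.
  rewrite (sumE (cst 1%R))// -ge0_mule_fsuml.
    congr (_ * _); apply: eq_fsbigr => r _; congr (_ * _).
    under eq_integral do rewrite mulr1 -[X in X%:E]/(\1_(U @^-1` (g n @^-1` [set r])) _).
    by rewrite integral_indic ?setIT//; exact: measurable_funPTI.
  move=> r; have [r0|r0] := leP 0%R r; first by rewrite mule_ge0.
  by rewrite neg// preimage_set0 measure0 mule0.
have cvgL : \int[P]_x (g n (U x) * Z x)%:E @[n --> \oo] -->
    \int[P]_x (f (U x) * Z x)%:E.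
  rewrite [X in _ --> X](_ : _ = \int[P]_x (limn (fun n => (g n (U x) * Z x)%:E))).
    apply: cvg_monotone_convergence => //.
    - by move=> n; exact/measurable_EFinP/measurable_funM.
    - by move=> n x _; rewrite lee_fin mulr_ge0.
    - by move=> x _ m n mn; rewrite lee_fin ler_wpM2r// ndg.
  apply: eq_integral => x _; apply/esym/cvg_lim => //.
  by under eq_fun do rewrite EFinM; rewrite EFinM; exact: cvgeZr.
have cvgR : (\int[P]_x (g n (U x))%:E) * c @[n --> \oo] -->
    (\int[P]_x (f (U x))%:E) * c.
  apply: cvgeZr => //.
  rewrite [X in _ --> X](_ : _ = \int[P]_x (limn (fun n => (g n (U x))%:E))).
    apply: cvg_monotone_convergence => //.
    - by move=> n; exact/measurable_EFinP.
    - by move=> n x _; rewrite lee_fin.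
    - by move=> x _ m n mn; rewrite lee_fin ndg.
  by apply: eq_integral => x _; apply/esym/cvg_lim => //.
by rewrite (funext gE) in cvgL; apply: (cvg_unique _ cvgL).
Qed.

(** Indicators are replaced by general factors one at a time through [integral_mul_of_indic]; finite
    expectations make the product over the other indices an admissible constant there. *)
Lemma expectation_prod (I : finType) (D J : {set I}) (X : I -> {RV P >-> R})
    (F : I -> R -> R) :
  mutually_independent D X -> J \subset D ->
  (forall i, measurable_fun setT (F i)) -> (forall i y, 0 <= F i y)%R ->
  (forall i, i \in J -> \int[P]_x (F i (X i x))%:E < +oo) ->
  \int[P]_x (\prod_(i in J) F i (X i x))%:E =
  \prod_(i in J) \int[P]_x (F i (X i x))%:E.
Proof.
move=> indX JD.
(* Outside s the factors are still indicators; the base case s = [::] is the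
   independence of events. *)
suff H (s : seq I) : forall F : I -> R -> R,
    (forall i, measurable_fun setT (F i)) -> (forall i y, 0 <= F i y)%R ->
    (forall i, i \in J -> \int[P]_x (F i (X i x))%:E < +oo) ->
    (forall i, i \in J -> i \notin s ->
       exists2 B : set R, measurable B & F i = \1_B) ->
    \int[P]_x (\prod_(i in J) F i (X i x))%:E =
    \prod_(i in J) \int[P]_x (F i (X i x))%:E.
  move=> mF F0 Foo; apply: (H (enum J)) => // i iJ.
  by rewrite mem_enum iJ.
have mX i B : measurable B -> measurable (X i @^-1` B).
  by move=> mB; exact: measurable_funPTI.
elim: s => [|j s IH] {F} F mF F0 Foo FB.
  have /choice[B HB] : forall i, exists B : set R, measurable B /\
      (i \in J -> F i = \1_B).
    move=> i; have [iJ|iJ] := boolP (i \in J); last by exists setT.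
    by have [B mB FE] := FB i iJ isT; exists B.
  have mB i : measurable (B i) by have [] := HB i.
  have FE i : i \in J -> F i = \1_(B i) by have [] := HB i.
  transitivity (P (\bigcap_(i in [set` J]) X i @^-1` B i)).
    rewrite -[RHS](_ : \int[P]_x (\1_(\bigcap_(i in [set` J]) X i @^-1` B i) x)%:E = _); last first.
      rewrite integral_indic ?setIT//.
      by apply: fin_bigcap_measurable => // i _; exact: mX.
    apply: eq_integral => x _; congr EFin.
    transitivity (\prod_(i in J) (\1_(X i @^-1` B i) x : R))%R.
      by apply: eq_bigr => i iJ; rewrite FE.
    rewrite indicE; have [xB|xB] := boolP (x \in _).
      rewrite big1// => i iJ; rewrite indicE mem_set//.
      by move: xB; rewrite inE; apply; exact: iJ.
    have [i [iJ xBi]] : exists i, i \in J /\ ~ (X i @^-1` B i) x.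
      apply: contrapT => /forallNP xJ; move/negP: xB; apply; rewrite inE => i iJ.
      by apply: contrapT => xBi; exact: (xJ i).
    by rewrite (bigD1 i iJ)/= indicE memNset// mul0r.
  rewrite indX//; apply: eq_bigr => i iJ.
  rewrite FE// -[X i @^-1` B i in LHS]setIT -integral_indic//; exact: mX.
have [jJ|jJ] := boolP (j \in J); last first.
  apply: IH => // i iJ iNs; apply: FB => //.
  by rewrite inE negb_or iNs andbT; apply: contraNneq jJ => <-.
have step := @integral_mul_of_indic (X j)
  (fun x => \prod_(i in J | i != j) F i (X i x))%R
  (\prod_(i in J | i != j) \int[P]_x (F i (X i x))%:E) (F j) _ _ _ (mF j) (F0 j).
have intfin i : i \in J -> \int[P]_x (F i (X i x))%:E \is a fin_num.
  move=> iJ; rewrite ge0_fin_numE ?Foo//.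
  by apply: integral_ge0 => x _; rewrite lee_fin.
rewrite [RHS](bigD1 j)//= -step.
- by apply: eq_integral => x _; rewrite (bigD1 j).
- under eq_fun do rewrite -big_filter.
  by apply: measurable_prod => i _; exact: measurableT_comp.
- by move=> x; apply: prodr_ge0 => i _.
- by apply: prode_fin_num => i /andP[iJ _]; exact: intfin.
- move=> A mA.
  (* With an indicator as factor [j], only the indices in [s] remain unrestricted, so the induction
     hypothesis applies to [F']. *)
  pose F' i := if i == j then \1_A else F i.
  have F'E i : i != j -> F' i = F i by rewrite /F' => /negbTE ->.
  have F'j : F' j = \1_A by rewrite /F' eqxx.
  have intA : \int[P]_x (\1_A (X j x))%:E = P (X j @^-1` A).
    by rewrite -[X j @^-1` A in RHS]setIT -integral_indic//; exact: mX.
  have -> : \prod_(i in J | i != j) \int[P]_x (F i (X i x))%:E =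
      \prod_(i in J | i != j) \int[P]_x (F' i (X i x))%:E.
    by apply: eq_bigr => i /andP[_ ij]; rewrite F'E.
  have := IH F' _ _ _ _.
  rewrite [RHS](bigD1 j)//= F'j intA => <-.
  + apply: eq_integral => x _; rewrite [in RHS](bigD1 j)//= F'j; congr (_ * _)%:E.
    by apply: eq_bigr => i /andP[_ ij]; rewrite F'E.
  + by move=> i; rewrite /F'; case: ifP.
  + by move=> i y; rewrite /F'; case: ifP.
  + move=> i iJ; have [->|ij] := eqVneq i j; last by rewrite F'E ?Foo.
    by rewrite F'j intA (le_lt_trans (probability_le1 _ (mX _ _ _)))// ltry.
  + move=> i iJ iNs; have [->|ij] := eqVneq i j; first by exists A.
    by rewrite F'E//; apply: FB => //; rewrite inE negb_or ij.
Qed.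
End ProductExpectation.

(** * Union, Markov and Chernoff bounds *)

Section Tails.
Context {R : realType} {d : measure_display} {T : measurableType d}.
Variable P : probability T R.

Lemma measurable_superlevel (f : T -> R) (a : R) :
  measurable_fun setT f -> measurable [set x | a <= f x].
Proof.
move=> mf; rewrite (_ : [set _ | _] = f @^-1` `[a, +oo[%classic).
  by rewrite -[_ @^-1` _]setTI; exact: mf.
by apply/seteqP; split => x /=; rewrite in_itv/= andbT.
Qed.

Lemma probability_le_sum (I : finType) (J : {set I}) (A : I -> set T)
    (B : set T) :
  (forall i, measurable (A i)) -> measurable B ->
  (forall x, B x -> exists2 i, i \in J & A i x) ->
  (P B <= \sum_(i in J) P (A i))%E.
Proof.
move=> mA mB BA; rewrite -big_enum fsbig_seq ?enum_uniq//.
apply: content_sub_fsum => //.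
by move=> x /BA[i iJ Aix]; exists i => //=; rewrite mem_enum.
Qed.

Lemma markov_ge0 (f : T -> R) (c : R) (B : set T) :
  measurable B -> measurable_fun setT f -> (forall x, 0 <= f x) -> 0 < c ->
  (forall x, B x -> c <= f x) ->
  (P B <= c^-1%:E * \int[P]_x (f x)%:E)%E.
Proof.
move=> mB mf f0 c0 Bf.
rewrite -[B in P B]setIT -integral_indic// -ge0_integralZl ?lee_fin ?invr_ge0 ?(ltW c0)//; last 2 first.
- exact/measurable_EFinP.
- by move=> x _; rewrite lee_fin.
apply: ge0_le_integral => //.
- exact/measurable_EFinP.
- apply/measurable_EFinP.
  exact: measurable_funM.
move=> x _; rewrite -EFinM lee_fin indicE; have [xB|xB] := boolP (x \in B).
  by rewrite mulrC ler_pdivlMr// mul1r Bf//; exact: set_mem.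
by rewrite mulr_ge0// invr_ge0 ltW.
Qed.

(** Markov's inequality for the exponential of the sum, whose expectation factorises by
    independence. The Chernoff parameter is contained in [phi], and [b i] bounds the logarithm of
    the moment generating function. *)
Lemma exp_tail (I : finType) (D J : {set I}) (X : I -> {RV P >-> R})
    (phi : R -> R) (a : R) (b : I -> R) :
  mutually_independent D X -> J \subset D -> measurable_fun setT phi ->
  (forall i, i \in J ->
    (\int[P]_x (expR (phi (X i x)))%:E <= (expR (b i))%:E)%E) ->
  (P [set x | (a <= \sum_(i in J) phi (X i x))%R]
    <= (expR (\sum_(i in J) b i - a))%:E)%E.
Proof.
move=> indX JD mphi Hb.
have mphiX i : measurable_fun setT (fun x => phi (X i x)).
  exact: measurableT_comp.
have msum : measurable_fun setT (fun x => \sum_(i in J) phi (X i x)).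
  rewrite (_ : (fun _ => _) = fun x =>
      \sum_(i <- [seq i <- index_enum I | i \in J]) phi (X i x)).
    exact: measurable_sum.
  by apply/funext => x; rewrite big_filter.
have prodE : (\int[P]_x (expR (\sum_(i in J) phi (X i x)))%:E <=
    (expR (\sum_(i in J) b i))%:E)%E.
  under eq_integral do rewrite expR_sum.
  have mexpphi : measurable_fun setT (expR \o phi).
    by apply: measurableT_comp => //; exact: measurable_expR.
  rewrite (expectation_prod (F := fun _ => expR \o phi) indX)//=; last first.
    by move=> i iJ; rewrite (le_lt_trans (Hb i iJ))// ltry.
  rewrite expR_sum.
  (* Upper bounds multiply only for nonnegative factors, so nonnegativity is carried along. *)
  pose le0 (x : \bar R) (y : R) := (0 <= x <= y%:E)%E.
  suff /andP[] : le0 (\prod_(i in J) \int[P]_x (expR (phi (X i x)))%:E)%E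
      (\prod_(i in J) expR (b i)) by [].
  apply: (big_ind2 le0) => [|x1 y1 x2 y2 /andP[x10 x1y1] /andP[x20 x2y2]|i iJ].
  - by rewrite /le0 lee_fin ler01 lexx.
  - by rewrite /le0 mule_ge0//= EFinM lee_pmul.
  - rewrite /le0 Hb// andbT; apply: integral_ge0 => x _.
    by rewrite lee_fin expR_ge0.
apply: (le_trans (markov_ge0 (f := fun x => expR (\sum_(i in J) phi (X i x))) (c := expR a) _ _ _ _ _)).
- exact: measurable_superlevel.
- by apply: measurableT_comp => //; exact: measurable_expR.
- by move=> x; exact: expR_ge0.
- exact: expR_gt0.
- by move=> x /=; rewrite ler_expR.
rewrite expRD mulrC EFinM expRN.
by apply: lee_wpmul2l => //; rewrite lee_fin invr_ge0 expR_ge0.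
Qed.

(** Using [expR u - 1 <= u * expR u] twice gives [expR u <= 1 + u + u ^+ 2 * expR u]. For
    [u = lam * min y t] the truncation bounds [expR u] by [expR th], while [y] and [y ^+ 2] are both
    at most [1 + y ^+ 2]. *)
Lemma truncated_exp_le (lam th t y : R) : 0 <= lam -> 0 <= t -> 0 <= y ->
  lam * t <= th ->
  expR (lam * Num.min y t) <= 1 + (lam + lam ^+ 2 * expR th) * (1 + y ^+ 2).
Proof.
move=> lam0 t0 y0 lamt; set z := Num.min y t.
have z0 : 0 <= z by rewrite le_min y0.
have zy : z <= y by rewrite ge_min lexx.
have zt : z <= t by rewrite ge_min lexx orbT.
set u := lam * z.
have u0 : 0 <= u by exact: mulr_ge0.
have uth : expR u <= expR th by rewrite ler_expR (le_trans _ lamt)// ler_wpM2l.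
have e1 : expR u - 1 <= u * expR u.
  have := expR_ge1Dx (- u); rewrite expRN => h.
  have := ler_wpM2r (expR_ge0 u) h.
  rewrite mulVf ?gt_eqF ?expR_gt0// mulrDl; lra.
have e2 : expR u <= 1 + u + u ^+ 2 * expR u.
  have := ler_wpM2l u0 e1; rewrite expr2; nra.
apply: (le_trans e2).
have h1 : u <= lam * (1 + y ^+ 2).
  rewrite ler_wpM2l// (le_trans zy)//; nra.
have h2 : u ^+ 2 * expR u <= lam ^+ 2 * expR th * (1 + y ^+ 2).
  have z2 : z ^+ 2 <= 1 + y ^+ 2.
    by rewrite (le_trans (lerXn2r 2 _ _ zy)) ?nnegrE// lerDr.
  rewrite {1}/u exprMn -[leRHS]mulrA -[leLHS]mulrA [in leLHS](mulrC (z ^+ 2)).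
  apply: ler_wpM2l; first exact: exprn_ge0.
  by apply: (ler_pM _ _ uth z2); [exact: expR_ge0|exact: exprn_ge0].
lra.
Qed.
End Tails.

(** * Tail of a sum of independent weights with bounded 2s-th moment *)

Section WeightTail.
Context {R : realType} {d : measure_display} {T : measurableType d}.
Variable P : probability T R.

(** Since [s >= 1], [y ^+ 2 <= 1 + y ^+ (2 * s)], so integrating [truncated_exp_le] gives at most
    [1 + c * (M + 2)], and [1 + x <= expR x] concludes. *)
Lemma truncated_exp_moment (W : {RV P >-> R}) (s : nat) (M lam th t : R) :
  (1 <= s)%N -> 0 <= M -> 0 <= lam -> 0 <= t -> lam * t <= th ->
  (\int[P]_x (`|W x| ^+ (2 * s))%:E <= M%:E)%E ->
  (\int[P]_x (expR (lam * Num.min `|W x| t))%:E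
    <= (expR ((lam + lam ^+ 2 * expR th) * (M + 2)))%:E)%E.
Proof.
move=> s1 M0 lam0 t0 lamt HM; set c := lam + _.
have c0 : 0 <= c by rewrite addr_ge0// mulr_ge0 ?expR_ge0 ?exprn_ge0.
have mabs : measurable_fun setT (fun x => `|W x|) by exact: measurableT_comp.
have mpow : measurable_fun setT (fun x => `|W x| ^+ (2 * s)).
  exact: measurable_funX.
have bound x : expR (lam * Num.min `|W x| t) <=
    1 + 2 * c + c * `|W x| ^+ (2 * s).
  apply: (le_trans (truncated_exp_le lam0 t0 (normr_ge0 _) lamt)).
  have pow2 : `|W x| ^+ 2 <= 1 + `|W x| ^+ (2 * s).
    have [y1|y1] := lerP `|W x| 1.
      rewrite (@le_trans _ _ 1)// ?exprn_ile1// lerDl exprn_ge0//.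
    rewrite (@le_trans _ _ (`|W x| ^+ (2 * s)))// ?lerDr//.
    by rewrite ler_weXn2l ?(ltW y1)// -[leqLHS]muln1 leq_mul2l.
  by rewrite -/c; nra.
apply: (@le_trans _ _ (\int[P]_x (1 + 2 * c + c * `|W x| ^+ (2 * s))%:E)%E).
  apply: ge0_le_integral => //.
  - apply/measurable_EFinP/measurableT_comp; first exact: measurable_expR.
    apply: measurable_funM => //; exact: measurable_minr.
  - apply/measurable_EFinP/measurable_funD => //; exact: measurable_funM.
  - by move=> x _; rewrite lee_fin.
under eq_integral do rewrite EFinD EFinM.
rewrite ge0_integralD//; last 3 first.
- by move=> x _; rewrite lee_fin addr_ge0// mulr_ge0.
- by move=> x _; rewrite mule_ge0// lee_fin exprn_ge0.
- by apply/measurable_EFinP/measurable_funM.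
have intc : (\int[P]_(_ in setT) (1 + 2 * c)%:E = (1 + 2 * c)%:E)%E.
  rewrite integral_cst//. 
  by rewrite -[RHS]mule1; congr (_ * _)%E; exact: probability_setT.
rewrite intc ge0_integralZl//; last exact/measurable_EFinP.
apply: (@le_trans _ _ (1 + 2 * c + c * M)%:E).
  by rewrite [leRHS]EFinD leeD2l// [leRHS]EFinM lee_wpmul2l.
rewrite lee_fin; apply: le_trans (expR_ge1Dx _); lra.
Qed.

(** The first term comes from the Chernoff bound for the truncated sum, the second from the weights
    above the truncation level [m / (3 * s)]; each is multiplied by [m ^- s]. *)
Definition tail_const (s : nat) (M : R) : R :=
  expR ((3 * s)%:R ^+ 2 * (M + 2)) + (3 * s)%:R ^+ (2 * s) * M.

(** Either some weight reaches the level [t], which is the event [U], or truncation at [t] leaves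
    the sum unchanged and [B1] occurs. *)
Lemma weight_sum_tail (I : finType) (D J : {set I}) (w : I -> {RV P >-> R})
    (s : nat) (M m : R) :
  mutually_independent D w -> J \subset D -> (1 <= s)%N -> 0 <= M ->
  (forall i, i \in D -> \int[P]_x (`|w i x| ^+ (2 * s))%:E <= M%:E)%E ->
  1 <= m -> #|J|%:R <= m ->
  (P [set x | ((M + 3) * m <= \sum_(i in J) `|w i x|)%R]
    <= (tail_const s M / m ^+ s)%:E)%E.
Proof.
move=> indw JD s1 M0 HM m1 Jm.
have m0 : 0 < m by exact: lt_le_trans m1.
pose K : R := (3 * s)%:R.
have K0 : 0 < K by rewrite ltr0n muln_gt0.
pose th := ln m / 3.
have th0 : 0 <= th by rewrite divr_ge0// ln_ge0.
pose t := m / K.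
have t0 : 0 < t by exact: divr_gt0.
pose lam := th / t.
have lam0 : 0 <= lam by rewrite divr_ge0// ltW.
(* th ^ 2 * expR th <= expR (3 * th) = m keeps the second-order term of the
   exponential moments bounded, while the linear gain is K * th = s * ln m. *)
have lamt : lam * t <= th by rewrite /lam divfK ?gt_eqF.
have mabs i : measurable_fun setT (fun x => `|w i x|) by exact: measurableT_comp.
have HMJ i : i \in J -> (\int[P]_x (`|w i x| ^+ (2 * s))%:E <= M%:E)%E.
  by move=> iJ; apply: HM; move/fintype.subsetP: JD; apply.
pose phi (y : R) := lam * Num.min `|y| t.
have mphi : measurable_fun setT phi.
  by apply: measurable_funM => //; exact: measurable_minr.
pose B1 := [set x | lam * ((M + 3) * m) <= \sum_(i in J) phi (w i x)].
pose A i := [set x | t <= `|w i x|].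
have mA i : measurable (A i) by exact: measurable_superlevel.
have mB1 : measurable B1.
  apply: measurable_superlevel.
  rewrite (_ : (fun _ => _) = fun x =>
      \sum_(i <- [seq i <- index_enum I | i \in J]) phi (w i x)).
    by apply: measurable_sum => i; exact: measurableT_comp.
  by apply/funext => x; rewrite big_filter.
have mB : measurable [set x | (M + 3) * m <= \sum_(i in J) `|w i x|].
  apply: measurable_superlevel.
  rewrite (_ : (fun _ => _) = fun x =>
      \sum_(i <- [seq i <- index_enum I | i \in J]) `|w i x|).
    by apply: measurable_sum.
  by apply/funext => x; rewrite big_filter.
pose U := \bigcup_(i in [set` J]) A i.
have mU : measurable U by exact: fin_bigcup_measurable.
(* The threshold factor [M + 3] exceeds the first-order coefficient [M + 2] by one; this surplus
   contributes [- lam * m = - s * ln m] to the exponent, hence the factor [m ^- s]. *)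
have PB1 : (P B1 <= (expR (K ^+ 2 * (M + 2)) / m ^+ s)%:E)%E.
  have := exp_tail (lam * ((M + 3) * m))
    (b := fun=> (lam + lam ^+ 2 * expR th) * (M + 2)) indw JD mphi _.
  move=> /(_ _)/le_trans; apply.
    by move=> i iJ; apply: (truncated_exp_moment s1 M0 lam0 (ltW t0) lamt (HMJ i iJ)).
  rewrite lee_fin.
  have mE : m ^- s = expR (- (K * th)).
    rewrite expRN; congr (_^-1).
    have -> : K * th = s%:R * ln m by rewrite /K /th natrM; field.
    by rewrite mulr_natl -lnXn// lnK// posrE exprn_gt0.
  rewrite mE -expRD ler_expR sumr_const -mulr_natl.
  have lamm : lam * m = K * th by rewrite /lam /t invf_div; field; rewrite gt_eqF.
  have em : m = expR th ^+ 2 * expR th.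
    by rewrite -exprSr -expRM_natr /th divfK// lnK// posrE.
  have the : th <= expR th by apply: le_trans (expR_ge1Dx _); rewrite lerDr.
  have e0 := expR_gt0 th.
  have thm : th ^+ 2 * expR th <= m.
    rewrite [leRHS]em ler_wpM2r ?(ltW e0)//.
    by rewrite lerXn2r// nnegrE// ltW.
  have lam2 : m * (lam ^+ 2 * expR th) <= K ^+ 2.
    rewrite -(ler_pM2r m0).
    have -> : m * (lam ^+ 2 * expR th) * m = (lam * m) ^+ 2 * expR th by ring.
    by rewrite lamm exprMn -mulrA ler_wpM2l// exprn_ge0// ltW.
  have b0 : 0 <= (lam + lam ^+ 2 * expR th) * (M + 2).
    by rewrite mulr_ge0 ?addr_ge0// mulr_ge0 ?exprn_ge0// ltW.
  have := ler_wpM2r b0 Jm.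
  have M2 : 0 <= M + 2 by lra.
  have := ler_wpM2r M2 lam2.
  have -> : m * ((lam + lam ^+ 2 * expR th) * (M + 2)) =
    (lam * m) * (M + 2) + m * (lam ^+ 2 * expR th) * (M + 2) by ring.
  have -> : lam * ((M + 3) * m) = (lam * m) * (M + 3) by ring.
  rewrite lamm; lra.
(* There are at most [m] weights, each reaching [t = m / K] with probability at most
   [M * (K / m) ^+ (2 * s)]; the factor [m] is absorbed because [m <= m ^+ s]. *)
have PU : (P U <= (K ^+ (2 * s) * M / m ^+ s)%:E)%E.
  apply: (le_trans (probability_le_sum (J := J) P mA mU (fun _ Ux => Ux))).
  have PA i : i \in J -> (P (A i) <= ((t ^+ (2 * s))^-1 * M)%:E)%E.
    move=> iJ; rewrite EFinM.
    apply: (le_trans (markov_ge0 P (f := fun x => `|w i x| ^+ (2 * s))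
      (c := t ^+ (2 * s)) _ _ _ _ _)) => //.
    - exact: measurable_funX.
    - exact: exprn_gt0.
    - by move=> x tw; rewrite lerXn2r ?nnegrE// ltW.
    by rewrite lee_wpmul2l ?HMJ// lee_fin invr_ge0 exprn_ge0// ltW.
  apply: (@le_trans _ _ (\sum_(i in J) ((t ^+ (2 * s))^-1 * M)%:E)%E).
    exact: lee_sum.
  rewrite sumEFin lee_fin sumr_const -mulr_natl.
  rewrite /t expr_div_n invf_div -!mulrA mulrCA ler_wpM2l ?exprn_ge0 ?(ltW K0)//.
  rewrite mulrC [leLHS]mulrAC mulrC ler_wpM2l//.
  rewrite mulrC ler_pdivrMr ?exprn_gt0// mul2n -addnn exprD mulrA mulVf ?mul1r.
    by rewrite (le_trans Jm)// -[leLHS]expr1 ler_weXn2l.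
  by rewrite expf_neq0// gt_eqF.
rewrite [X in X%:E]mulrDl EFinD; apply: le_trans (leeD PB1 PU).
apply: le_trans (measureU2 _ _ _) => //.
apply: le_measure; rewrite ?inE//; first exact: measurableU.
move=> x /= Hx.
have [[i iJ Aix]|noA] := pselect (exists2 i, i \in J & A i x).
  by right; exists i.
left; rewrite /B1/= -mulr_sumr ler_wpM2l//.
rewrite (le_trans Hx)// le_eqVlt; apply/orP; left; apply/eqP.
apply: eq_bigr => i iJ; apply/esym/min_l/ltW; rewrite ltNge.
by apply/negP => Aix; apply: noA; exists i.
Qed.

End WeightTail.

(** * Greedy weighted colouring along an ordering *)

Section GreedyColouring.
Context {R : realType} {n : nat}.
Implicit Types (H : {set {set 'I_n}}) (wt : {set 'I_n} -> R).

Lemma edge_inj (u : 'I_n) : injective (edge u).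
Proof.
move=> v v' /setP e.
have := e v'; rewrite !inE eqxx orbT => /orP[/eqP v'u|/eqP//].
by have := e v; rewrite v'u !inE eqxx orbT orbb => /esym/eqP.
Qed.

Lemma edgeC (u v : 'I_n) : edge u v = edge v u.
Proof. exact: finset.setUC. Qed.

(** The separation is strict: when [k] is the integer part of a real weight, the distance is then at
    least that weight. *)
Definition far (k a b : nat) := (a + k < b)%N || (b + k < a)%N.

(** The colours too close to [b] lie in a window of [2 * k + 1] integers starting at [b - k]; if the
    subtraction truncates at 0, the window still reaches beyond [b + k]. *)
Lemma card_not_far (N k b : nat) : (#|[set a : 'I_N | ~~ far k a b]%SET| <= k.*2.+1)%N.
Proof.
rewrite cardE -(size_map val) -[leqRHS](size_iota (b - k)).
apply: uniq_leq_size; first by rewrite (map_inj_uniq val_inj) enum_uniq.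
move=> _ /mapP[a + ->]; rewrite mem_enum inE mem_iota /far /=; lia.
Qed.

(** The neighbours already coloured when the greedy procedure, running by increasing rank [r],
    reaches [u]. *)
Definition back (H : {set {set 'I_n}}) (r : 'I_n -> nat) (u : 'I_n) : {set 'I_n} :=
  [set v | (edge u v \in H) && (r v < r u)%N]%SET.

(** Each coloured neighbour [v] forbids at most [2 * W + 1] colours, so at most [N] of the [N + 1]
    colours are forbidden and one is free. *)
Lemma greedy_colouring H (r : 'I_n -> nat) (W : {set 'I_n} -> nat) (N : nat) :
  H \subset K n -> injective r ->
  (forall u, \sum_(v in back H r u) (W (edge u v)).*2.+1 <= N)%N ->
  exists g : 'I_n -> 'I_N.+1,
    forall u v, edge u v \in H -> far (W (edge u v)) (g u) (g v).
Proof.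
move=> HK rinj sumW.
have farC k a b : far k a b = far k b a by rewrite /far orbC.
suff H' k : exists g : 'I_n -> 'I_N.+1, forall u v, (r u < k)%N -> (r v < r u)%N ->
    edge u v \in H -> far (W (edge u v)) (g u) (g v).
  have [g gP] := H' (\max_u r u).+1; exists g => u v uvH.
  have rlt x : (r x < (\max_u r u).+1)%N by rewrite ltnS leq_bigmax.
  have [ruv|ruv|/rinj uv] := ltngtP (r u) (r v).
  - by rewrite farC edgeC gP// edgeC.
  - exact: gP.
  - by move/fintype.subsetP/(_ _ uvH): HK; rewrite edge_K uv eqxx.
elim: k => [|k [g gP]]; first by exists (fun=> ord0).
(* Ranks need not be consecutive: if no vertex has rank [k], the colouring is kept. *)
have [[u0 ru0]|no] := pselect (exists u, r u = k); last first.
  exists g => u v; rewrite ltnS leq_eqVlt => /orP[/eqP ruk|]; last exact: gP.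
  by exfalso; apply: no; exists u.
pose F := (\bigcup_(v in back H r u0)
  [set a : 'I_N.+1 | ~~ far (W (edge u0 v)) a (g v)])%SET.
have [x xF] : exists x, x \notin F.
  apply/existsP; rewrite -negb_forall; apply/negP => /forallP allF.
  have : (#|F| <= N)%N.
    apply: leq_trans (sumW u0).
    apply: (big_ind2 (fun (A : {set 'I_N.+1}) k => #|A| <= k)%N).
    - by rewrite cards0.
    - move=> A a B b Aa Bb; apply: leq_trans (leq_card_setU _ _) _.
      exact: leq_add.
    - by move=> v _; exact: card_not_far.
  rewrite leqNgt => /negP; apply.
  have -> : F = [set: 'I_N.+1]%SET by apply/setP => y; rewrite inE; exact: allF.
  by rewrite cardsT card_ord.
exists (fun u => if u == u0 then x else g u) => u v ruk rvu uvH.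
have vu0 : v != u0.
  by apply: contraTneq ruk => vu0; rewrite -leqNgt -ru0 -vu0.
rewrite (negbTE vu0); have [uu0|uu0] := eqVneq u u0.
  apply: contraR xF => nfar; apply/bigcupP; exists v.
    by rewrite inE -uu0 uvH rvu.
  by rewrite inE -uu0.
apply: gP => //; move: ruk; rewrite ltnS leq_eqVlt => /orP[/eqP ruk|//].
by move/eqP: uu0; rewrite -ru0 in ruk; move/rinj: ruk.
Qed.

(** The greedy colouring is run with the integer parts of the weights and of [c]. Colours are then
    shifted by one to become positive, which leaves the spread at most [N <= c]. *)
Lemma chi_w_le H wt (r : 'I_n -> nat) (c : R) :
  H \subset K n -> injective r -> 0 <= c ->
  (forall u, \sum_(v in back H r u) (2 * `|wt (edge u v)| + 1) <= c) ->
  chi_w H wt <= c.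
Proof.
move=> HK rinj c0 sumc.
pose W e := Num.truncn `|wt e|; pose N := Num.truncn c.
have Wle e : (W e)%:R <= `|wt e| by rewrite truncn_le.
have wtlt e : `|wt e| < (W e).+1%:R by rewrite truncnS_gt.
have [|g gP] := @greedy_colouring H r W N HK rinj.
  move=> u; rewrite truncn_ge_nat// natr_sum; apply: le_trans (sumc u).
  apply: ler_sum => v _; rewrite -addn1 natrD -mul2n natrM lerD2r ler_wpM2l//.
have [f [_ -> fmin]] := chi_w_min wt HK.
have /fmin : proper_wcolouring H wt (fun u => (g u).+1).
  split=> // u v /gP; rewrite /far.
  wlog guv : u v / (g u + W (edge u v) < g v)%N => [wl /orP[uv|vu]|_].
  - by apply: wl => //; rewrite uv.
  - by rewrite distrC edgeC; apply: wl; rewrite edgeC vu.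
  rewrite distrC -natrB ?ltnS; last by lia.
  rewrite normr_nat subSS; apply: (le_trans (ler_norm _)).
  by rewrite (le_trans (ltW (wtlt (edge u v))))// ler_nat; lia.
rewrite -(ler_nat R) => /le_trans; apply.
rewrite (@le_trans _ _ N%:R)// ?truncn_le// ler_nat.
apply/bigmax_leqP => -[u v] _ /=; have := ltn_ord (g u); have := ltn_ord (g v).
lia.
Qed.
End GreedyColouring.

(** * Ordering by decreasing degree *)

Section Degree.
Context {n : nat}.
Implicit Types H : {set {set 'I_n}}.

Definition degree H (u : 'I_n) : nat := #|[set v | edge u v \in H]%SET|.

(** Double counting of incidences: neighbours of [u] inject into the edges containing [u], and every
    edge has two endpoints. *)
Lemma sum_degree_le H : H \subset K n -> (\sum_u degree H u <= #|H|.*2)%N.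
Proof.
move=> HK.
have degE u : (degree H u <= \sum_(e in H) (u \in e))%N.
  rewrite /degree -(card_imset _ (edge_inj (u := u))) -sum1_card.
  rewrite [leqRHS](bigID (fun e : {set 'I_n} => u \in e))/=.
  apply: leq_trans (leq_addr _ _).
  rewrite [leqRHS](eq_bigr (fun=> 1%N)); last by move=> e /andP[_ ->].
  rewrite !sum1_card; apply/subset_leq_card/fintype.subsetP => e.
  by move=> /imsetP[v]; rewrite inE => uvH ->; rewrite unfold_in uvH !inE eqxx.
apply: (@leq_trans (\sum_u \sum_(e in H) (u \in e))%N); first exact: leq_sum.
rewrite exchange_big/= -muln2 -sum_nat_const; apply: leq_sum => e eH.
move/fintype.subsetP/(_ _ eH): HK; rewrite inE => /eqP <-.
by rewrite -sum1_card [leqRHS]big_mkcond/=; apply: leq_sum => u _; case: ifP.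
Qed.

(* Decreasing degree first, then increasing index. *)
Definition degree_rank H (u : 'I_n) : nat := ((n - degree H u) * n + u)%N.

Lemma degree_rank_inj H : injective (degree_rank H).
Proof.
move=> u v /(congr1 (modn^~ n)); rewrite /degree_rank !modnMDl !modn_small//.
by move/val_inj.
Qed.

(** If [u] has [k] earlier neighbours, each of them has degree at least that of [u], hence at least
    [k]; so [k ^ 2] is at most the sum of all degrees. *)
Lemma card_back_degree_rank H (u : 'I_n) : H \subset K n ->
  (#|back H (degree_rank H) u| ^ 2 <= #|H|.*2)%N.
Proof.
move=> HK; set B := back _ _ _.
have Bdeg : (#|B| <= degree H u)%N.
  by apply/subset_leq_card/fintype.subsetP => v; rewrite !inE => /andP[].
apply: leq_trans (sum_degree_le HK).
rewrite [leqRHS](bigID (mem B))/=; apply: leq_trans (leq_addr _ _).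
rewrite -mulnn -sum_nat_const; apply: leq_sum => v.
rewrite inE /degree_rank => /andP[_ rvu]; apply: leq_trans Bdeg _.
(* If [v] had smaller degree than [u], this bound would make the leading term of its rank larger by
   at least [n > u], contradicting [rvu]. *)
have degn : (degree H u <= n)%N by rewrite -[leqRHS]card_ord max_card.
rewrite leqNgt; apply/negP => duv.
have := ltn_ord u; nia.
Qed.
End Degree.

(** * Measurability and probability of the good event *)

Section GoodEvent.
Context {R : realType} {d : measure_display} {T : measurableType d}.
Variables (P : probability T R) (n : nat).
Implicit Types (X w : {set 'I_n} -> {RV P >-> R}) (H : {set {set 'I_n}}).

(** As the minimum is attained, the event is the union, over the countably many colourings of spread
    at most [a], of the events that the colouring is proper, which are finite intersections of
    half-line conditions. *)
Lemma measurable_chi_w H w (a : R) : H \subset K n ->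
  measurable [set y | chi_w H (fun e => w e y) <= a].
Proof.
move=> HK.
pose F (f : {ffun 'I_n -> nat}) : set T :=
  if `[< (forall u, (0 < f u)%N) /\ (spread H f)%:R <= a >]
  then \bigcap_(q in [set q : 'I_n * 'I_n | edge q.1 q.2 \in H])
    [set y | w (edge q.1 q.2) y <= `|(f q.1)%:R - (f q.2)%:R|]
  else set0.
rewrite (_ : [set _ | _] = \bigcup_f F f); last first.
  apply/seteqP; split => y /=.
    have [f [[f0 pf] -> _]] := chi_w_min (fun e => w e y) HK => fa.
    exists [ffun u => f u] => //; rewrite /F; case: asboolP => [_|].
      by move=> [u v]/= uvH; rewrite !ffunE; exact: pf.
    case; split; first by move=> u; rewrite ffunE.
    by rewrite (_ : finfun _ = f :> ('I_n -> nat))//; apply/funext => u; rewrite ffunE.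
  move=> [f _]; rewrite /F; case: asboolP => // -[f0 fa] pf.
  have [g [_ -> gmin]] := chi_w_min (fun e => w e y) HK.
  apply: le_trans fa; rewrite ler_nat; apply: gmin; split => // u v uvH.
  exact: (pf (u, v)).
apply: countable_bigcupT_measurable => [|f]; first exact: countableP.
rewrite /F; case: asboolP => // _; apply: fin_bigcap_measurable => // q _.
rewrite (_ : [set _ | _] =
    w (edge q.1 q.2) @^-1` `]-oo, `|(f q.1)%:R - (f q.2)%:R|]%classic).
  exact: measurable_funPTI.
by apply/seteqP; split => y /=; rewrite in_itv.
Qed.

Lemma measurable_random_graph X H : measurable (random_graph X @^-1` [set H]).
Proof.
pose A (H : {set {set 'I_n}}) e : set T := if e \in K n then
  (if e \in H then X e @^-1` [set 1] else X e @^-1` (~` [set 1]))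
  else if e \in H then set0 else setT.
rewrite (_ : _ @^-1` _ = \bigcap_(e in setT) A H e).
  apply: fin_bigcap_measurable => // e _; rewrite /A.
  case: ifP => _; case: ifP => // _; apply: measurable_funPTI => //.
  exact: measurableC.
apply/seteqP; split => x /=.
  move=> <- e _; rewrite /A [e \in random_graph _ _]inE.
  case: (e \in K n) => //=; by case: eqP.
move=> xA; apply/setP => e; have := xA e I; rewrite /A [e \in random_graph _ _]inE.
case: (e \in K n) => /=; last by case: (e \in H).
case: (e \in H) => /=; first by move=> ->; rewrite eqxx.
by move=> /eqP/negbTE.
Qed.

Lemma measurable_graph_event X (Q : set {set {set 'I_n}}) :
  measurable (random_graph X @^-1` Q).
Proof.
rewrite (_ : _ @^-1` _ = \bigcup_(H in Q) random_graph X @^-1` [set H]).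
  apply: fin_bigcup_measurable => [|H _]; first exact: finite_finset.
  exact: measurable_random_graph.
apply/seteqP; split => x /=; first by exists (random_graph X x).
by move=> [H QH xH]; rewrite /= xH.
Qed.

(** Membership of [x] depends only on the graph at [x], which takes finitely many values. *)
Lemma measurable_E_good X w (C eps1 eps2 : R) :
  measurable (E_good X w C eps1 eps2).
Proof.
exact: (measurable_graph_event X [set H | (1 - C / n%:R `^ eps2)%:E <=
  P [set y | (chi_w H (fun e => w e y) <= C * n%:R `^ eps1)%R]]%E).
Qed.

(** Off the union over [u] of the events of [weight_sum_tail], the greedy sums are at most
    [2 * (M + 3) * m + m = (2 * M + 7) * m]. *)
Lemma chi_w_tail w H (r : 'I_n -> nat) (s : nat) (M m : R) :
  mutually_independent (K n) w -> H \subset K n -> injective r ->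
  (1 <= s)%N -> 0 <= M ->
  (forall e, e \in K n -> \int[P]_x (`|w e x| ^+ (2 * s))%:E <= M%:E)%E ->
  1 <= m -> (forall u, #|back H r u|%:R <= m) ->
  ((1 - n%:R * (tail_const s M / m ^+ s))%:E <=
    P [set y | (chi_w H (fun e => w e y) <= (2 * M + 7) * m)%R])%E.
Proof.
move=> indw HK rinj s1 M0 HM m1 backm.
have m0 : 0 < m by exact: lt_le_trans m1.
pose J u := (edge u @: back H r u)%SET.
have JK u : J u \subset K n.
  apply/fintype.subsetP => e /imsetP[v]; rewrite inE => /andP[uvH _] ->.
  by move/fintype.subsetP : HK; exact.
have Jm u : #|J u|%:R <= m by rewrite card_imset//; exact: edge_inj.
set G := [set _ | _].
have mG : measurable G by exact: measurable_chi_w.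
pose A u := [set y | (M + 3) * m <= \sum_(e in J u) `|w e y|].
have mA u : measurable (A u).
  apply: measurable_superlevel.
  rewrite (_ : (fun _ => _) = fun x =>
      \sum_(e <- [seq e <- index_enum _ | e \in J u]) `|w e x|).
    by apply: measurable_sum => e; exact: measurableT_comp.
  by apply/funext => x; rewrite big_filter.
have PG : (P (~` G) <= (n%:R * (tail_const s M / m ^+ s))%:E)%E.
  apply: (le_trans (probability_le_sum P (J := [set: 'I_n]%SET) mA (measurableC mG) _)).
    move=> y; apply: contra_notP => noA.
    apply: (chi_w_le HK rinj).
      by rewrite mulr_ge0 ?(ltW m0)// addr_ge0// mulr_ge0.
    move=> u; rewrite big_split/= -mulr_sumr sumr_const.
    have : \sum_(v in back H r u) `|w (edge u v) y| <= (M + 3) * m.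
      rewrite leNgt; apply/negP => /ltW Au; apply: noA; exists u; rewrite ?inE//.
      rewrite /A/= big_imset// => v v' _ _; exact: edge_inj.
    have := backm u; lra.
  apply: (@le_trans _ _ (\sum_(u in [set: 'I_n]%SET) (tail_const s M / m ^+ s)%:E)%E).
    by apply: lee_sum => u _; exact: (weight_sum_tail indw (JK u) s1 M0 HM m1 (Jm u)).
  by rewrite sumEFin lee_fin sumr_const cardsT card_ord mulr_natl.
rewrite -[G]setCK probability_setC; last exact: measurableC.
by rewrite EFinB leeB.
Qed.

(** Common frame of both cases: it remains to choose an ordering, which may depend on the graph, and
    an exceptional event [B] outside which every vertex has at most [m] earlier neighbours. *)
Lemma E_good_prob X w (r : {set {set 'I_n}} -> 'I_n -> nat) (s : nat)
    (M m C eps1 eps2 delta : R) (B : set T) :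
  mutually_independent (K n) w -> (forall H, injective (r H)) ->
  (1 <= s)%N -> 0 <= M ->
  (forall e, e \in K n -> \int[P]_x (`|w e x| ^+ (2 * s))%:E <= M%:E)%E ->
  1 <= m -> (2 * M + 7) * m <= C * n%:R `^ eps1 ->
  n%:R * (tail_const s M / m ^+ s) <= C / n%:R `^ eps2 ->
  measurable B -> (P B <= delta%:E)%E ->
  (forall x, ~ B x ->
    forall u, #|back (random_graph X x) (r (random_graph X x)) u|%:R <= m) ->
  ((1 - delta)%:E <= P (E_good X w C eps1 eps2))%E.
Proof.
move=> indw rinj s1 M0 HM m1 mC tC mB PB backm.
apply: (@le_trans _ _ (P (~` B))).
  by rewrite probability_setC// EFinB leeB.
apply: le_measure; rewrite ?inE; [exact: measurableC|exact: measurable_E_good|].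
move=> x Bx; rewrite /E_good/=; set H := random_graph X x.
have HK : H \subset K n by apply/fintype.subsetP => e; rewrite inE => /andP[].
apply: le_trans (le_trans (chi_w_tail indw HK (rinj H) s1 M0 HM m1 (backm x Bx)) _).
  by rewrite lee_fin lerB.
apply: le_measure; rewrite ?inE; [exact: measurable_chi_w..|].
by move=> y /= /le_trans; exact.
Qed.

(** Chernoff with parameter 1: the exponential moment of a Bernoulli variable is
    [1 + (expR 1 - 1) * p e], at most [expR ((expR 1 - 1) * p e)]. The indicator [phi] mirrors the
    test [X e x == 1] defining the graph. *)
Lemma edge_count_tail X (p : {set 'I_n} -> R) (J : {set {set 'I_n}}) (a : R) :
  mutually_independent (K n) X -> J \subset K n ->
  (forall e, e \in K n -> bernoulli_RV (X e) (p e)) ->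
  (P [set x | (a <= #|random_graph X x :&: J|%SET%:R)%R] <=
    (expR ((expR 1 - 1) * \sum_(e in J) p e - a))%:E)%E.
Proof.
move=> indX JK HX; pose phi : R -> R := \1_[set 1].
have in1 (y : R) : (y \in [set 1]%classic) = (y == 1).
  by apply/idP/eqP; rewrite inE.
have mphi : measurable_fun setT phi by exact: measurable_indic.
rewrite (_ : [set _ | _] = [set x | a <= \sum_(e in J) phi (X e x)]); last first.
  have H x : #|random_graph X x :&: J|%SET%:R = \sum_(e in J) phi (X e x).
    rewrite -sum1_card natr_sum [RHS]big_mkcond [LHS]big_mkcond/=.
    apply: eq_bigr => e _; rewrite finset.in_setI andbC.
    have [eJ|//] := boolP (e \in J).
    rewrite [e \in random_graph _ _]inE (fintype.subsetP JK)//= /phi indicE in1.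
    by case: eqP.
  by apply/seteqP; split => x /=; rewrite H.
rewrite mulr_sumr; apply: (exp_tail a (b := fun e => (expR 1 - 1) * p e) indX JK mphi).
move=> e eJ; have eK : e \in K n by move/fintype.subsetP: JK; exact.
have [HX1 _] := HX e eK.
have mX1 : measurable (X e @^-1` [set 1]) by exact: measurable_funPTI.
have e1 : 0 <= expR 1 - 1 :> R by rewrite subr_ge0 -[leLHS]expR0 ler_expR.
have E x : (expR (phi (X e x)))%:E =
    (1 + (expR 1 - 1)%:E * (\1_(X e @^-1` [set 1]) x)%:E)%E.
  rewrite -EFinM -EFinD; congr EFin; rewrite /phi !indicE in1.
  rewrite (_ : (x \in X e @^-1` [set 1]) = (X e x == 1)); last first.
    by apply/idP/eqP; rewrite inE.
  by case: eqP => _; rewrite ?expR0 ?mulr1 ?mulr0 ?addr0 ?subrKC.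
under eq_integral do rewrite E.
rewrite ge0_integralD//; last first.
  by apply/measurable_EFinP; apply: measurable_funM.
rewrite ge0_integralZl//; last exact/measurable_EFinP.
have -> : (\int[P]_x (\1_(X e @^-1` [set 1]) x)%:E = (p e)%:E)%E.
  by rewrite integral_indic// setIT; exact: HX1.
have -> : (\int[P]_x 1 = 1)%E.
  by rewrite integral_cst// mul1e; exact: probability_setT.
by rewrite -EFinM -EFinD lee_fin expR_ge1Dx.
Qed.

End GoodEvent.

(** * Estimates for real powers *)

Section Powers.
Context {R : realType}.
Implicit Types a c C L : R.

Lemma one_le_powR a (x : R) : 1 <= a -> 0 <= x -> 1 <= a `^ x.
Proof. by move=> a1 x0; rewrite -[leLHS](powRr0 a) ler_powR. Qed.

(** Serves to absorb the factor [n] of a union bound into an exponential of a power of [n]. *)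
Lemma ln_le_powR a (x : R) : 1 <= a -> 0 < x -> ln a <= x^-1 * a `^ x.
Proof.
move=> a1 x0; rewrite mulrC ler_pdivlMr// mulrC -ln_powR.
have p0 : 0 < a `^ x by rewrite powR_gt0// (lt_le_trans _ a1).
rewrite -[leRHS]lnK ?posrE//.
by apply: le_trans (expR_ge1Dx _); rewrite lerDr.
Qed.

(** Turns the failure probability [n * (c / m ^+ s)] with [m = L * n ^ x] into the form required by
    [E_good]; [L >= 1] only enlarges the denominator. *)
Lemma div_powR_le a c C L (x y : R) (s : nat) :
  1 <= a -> 0 <= c -> c <= C -> 1 <= L -> y <= s%:R * x - 1 ->
  a * (c / (L * a `^ x) ^+ s) <= C / a `^ y.
Proof.
move=> a1 c0 cC L1 yx.
have a0 : 0 < a by exact: lt_le_trans a1.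
have ax : 0 < a `^ x by exact: powR_gt0.
have le1 : (a `^ x) ^+ s <= (L * a `^ x) ^+ s.
  rewrite lerXn2r ?nnegrE ?mulr_ge0 ?(ltW ax) ?(le_trans ler01)//.
  by rewrite ler_peMl// ltW.
apply: (@le_trans _ _ (a * (c / (a `^ x) ^+ s))).
  rewrite ler_wpM2l ?(ltW a0)// ler_wpM2l// lef_pV2 ?posrE ?exprn_gt0//.
  by rewrite mulr_gt0// (lt_le_trans ltr01).
rewrite mulrCA; apply: ler_pM => //.
  by rewrite mulr_ge0 ?(ltW a0)// invr_ge0 exprn_ge0// ltW.
rewrite ler_pdivrMr ?exprn_gt0// -powR_mulrn ?(ltW ax)// -powRrM.
rewrite mulrC ler_pdivlMr ?powR_gt0// -{1}[a]powRr1 ?(ltW a0)//.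
by rewrite -powRD ?(gt_eqF a0) ?implybT// ler_powR//; lra.
Qed.

Lemma mul_div_powR a C (x y z : R) : 1 <= a -> z = x + y ->
  a `^ z * (C / a `^ x) = C * a `^ y.
Proof.
move=> a1 ->; have a0 : 0 < a by exact: lt_le_trans a1.
rewrite powRD ?(gt_eqF a0) ?implybT//; field.
by rewrite gt_eqF// powR_gt0.
Qed.

End Powers.

(** The law [nu] is common to all [n], so the moment of the single edge of [K 2] serves as a bound
    independent of [n]. *)
Lemma moment_bound (R : realType)
  (d : nat -> measure_display) (T : forall n : nat, measurableType (d n))
  (P : forall n : nat, probability (T n) R)
  (w : forall n : nat, {set 'I_n} -> {RV (P n) >-> R})
  (nu : probability (measurableTypeR R) R) (s : nat) :
  (forall n (h : {set 'I_n}), h \in K n ->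
     forall B : set R, measurable B -> distribution (P n) (w n h) B = nu B) ->
  (forall n (h : {set 'I_n}), h \in K n ->
     ('E_(P n)[fun x => (w n h x ^+ (2 * s))%R] < +oo)%E) ->
  exists2 M : R, 0 <= M & forall n (h : {set 'I_n}), h \in K n ->
    (\int[P n]_x (`|w n h x| ^+ (2 * s))%:E <= M%:E)%E.
Proof.
move=> law mom.
have e2 : edge (ord0 : 'I_2) ord_max \in K 2 by rewrite edge_K.
pose f (y : R) := (`|y| ^+ (2 * s))%:E.
have mf : measurable_fun setT f.
  by apply/measurable_EFinP; apply: measurable_funX; exact: normr_measurable.
have f0 y : (0 <= f y)%E by rewrite lee_fin exprn_ge0.
pose I := (\int[P 2%N]_x f (w 2%N (edge ord0 ord_max) x))%E.
have IE n (h : {set 'I_n}) : h \in K n -> (\int[P n]_x f (w n h x))%E = I.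
  move=> hK; rewrite /I.
  have dE m (e : {set 'I_m}) :
      (\int[P m]_x f (w m e x) = \int[distribution (P m) (w m e)]_y f y)%E.
    by rewrite ge0_integral_distribution.
  rewrite !dE; apply: eq_measure_integral => A mA _.
  by rewrite [LHS]law// [RHS]law.
have I0 : (0 <= I)%E by exact: integral_ge0.
have Ioo : (I < +oo)%E.
  apply: le_lt_trans (mom _ _ e2).
  rewrite unlock le_eqVlt; apply/orP; left; apply/eqP; apply: eq_integral => x _.
  by rewrite /f !exprM -normrX ger0_norm// sqr_ge0.
exists (fine I); first exact: fine_ge0.
by move=> n h /IE; rewrite /f => ->; rewrite fineK// ge0_fin_numE.
Qed.

(** * Choice of constants in the two cases *)

Theorem theorem3 (R : realType)
  (d : nat -> measure_display) (T : forall n : nat, measurableType (d n))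
  (P : forall n : nat, probability (T n) R)
  (p : forall n : nat, {set 'I_n} -> R)
  (X w : forall n : nat, {set 'I_n} -> {RV (P n) >-> R})
  (nu : probability (measurableTypeR R) R) (mu0 : R) (s : nat)
  (hp : forall n (f : {set 'I_n}), f \in K n -> 0 <= p n f <= 1)
  (hX : forall n (f : {set 'I_n}), f \in K n -> bernoulli_RV (X n f) (p n f))
  (hXindep : forall n, mutually_independent (K n) (X n))
  (hwindep : forall n, mutually_independent (K n) (w n))
  (hwlaw : forall n (h : {set 'I_n}), h \in K n ->
     forall B : set R, measurable B -> distribution (P n) (w n h) B = nu B)
  (hXw : forall n, graph_indep_weights (X n) (w n))
  (hmu0 : 1 <= mu0)
  (hwmean : forall n (h : {set 'I_n}), h \in K n ->
     ('E_(P n)[w n h] = mu0%:E)%E)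
  (hw1 : forall n (h : {set 'I_n}), h \in K n ->
     {ae P n, forall x, 1 <= w n h x})
  (hs : (1 <= s)%N)
  (hwmoment : forall n (h : {set 'I_n}), h \in K n ->
     ('E_(P n)[fun x => (w n h x ^+ (2 * s))%R] < +oo)%E) :
  (forall C1 C2 beta : R, 0 < C1 -> 0 < C2 -> 0 < beta < 1 ->
     (forall n (u : 'I_n), (2 <= n)%N ->
        C1 / n%:R `^ beta <= p_av_at (p n) u <= C2 / n%:R `^ beta) ->
     s%:R > 1 / (1 - beta) ->
     exists2 C : R, 0 < C &
       forall n, (2 <= n)%N ->
         (P n (E_good (X n) (w n) C (1 - beta) (s%:R * (1 - beta) - 1))
            >= (1 - expR (- (C^-1 * n%:R `^ (1 - beta))))%:E)%E)
  /\
  (forall C1 C2 beta : R, 0 < C1 -> 0 < C2 -> 2 / s%:R < beta < 1 ->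
     (forall n, (2 <= n)%N ->
        C1 / n%:R `^ beta <= p_av (p n) <= C2 / n%:R `^ beta) ->
     forall gamma : R, 0 < gamma < beta / 2 - 1 / s%:R ->
     exists2 D : R, 0 < D &
       forall n, (2 <= n)%N ->
         (P n (E_good (X n) (w n) D (1 - gamma) beta)
            >= (1 - expR (- (D^-1 * n%:R `^ (2 - beta))))%:E)%E).
Proof.
have [M M0 HM] := moment_bound hwlaw hwmoment.
pose c := tail_const s M.
have c0 : 0 <= c.
  by rewrite /c /tail_const addr_ge0 ?expR_ge0// mulr_ge0// exprn_ge0.
pose e1 : R := expR 1 - 1.
have e10 : 0 <= e1 by rewrite subr_ge0 -[leLHS]expR0 ler_expR.
split.
- move=> C1 C2 beta _ C20 /andP[beta0 beta1] hav hsb.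
  pose x := 1 - beta; have x0 : 0 < x by rewrite subr_gt0.
  pose kappa := x^-1; have kappa0 : 0 < kappa by rewrite invr_gt0.
  (* Here [e1 * C2] offsets the mean term in the Chernoff exponent, [kappa] pays for [ln n] in the
     union bound over vertices, and 1 is the remaining decay rate. *)
  pose L := e1 * C2 + kappa + 1.
  have L1 : 1 <= L by rewrite lerDr addr_ge0 ?mulr_ge0 ?(ltW C20) ?(ltW kappa0).
  (* The summands give in turn [C^-1 <= 1], the bound on [chi_w] and the bound on the failure
     probability of the weights. *)
  pose C := 1 + (2 * M + 7) * L + c.
  have ML0 : 0 <= (2 * M + 7) * L.
    by apply: mulr_ge0; lra.
  exists C; first by rewrite ltr_pwDl// ltr_pwDl.
  move=> n n2; pose a : R := n%:R.
  have a1 : 1 <= a by rewrite ler1n (leq_trans _ n2).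
  have a0 : 0 < a by exact: lt_le_trans a1.
  pose N := a `^ x; have N1 : 1 <= N by rewrite one_le_powR// ltW.
  have N0 : 0 < N by exact: lt_le_trans N1.
  (* All possible edges at [u], so that [A u] below says that the degree of [u] is at least
     [L * N]. *)
  pose J (u : 'I_n) := (edge u @: [set v | v != u]%SET)%SET.
  have JK u : J u \subset K n.
    apply/fintype.subsetP => e /imsetP[v]; rewrite inE => vu ->.
    by rewrite edge_K eq_sym.
  have sumJ u : \sum_(e in J u) p n e <= C2 * N.
    rewrite big_imset/=; last by move=> v v' _ _; exact: edge_inj.
    rewrite (eq_bigl (fun v => v != u)); last by move=> v; rewrite inE.
    have /andP[_] := hav n u n2; rewrite /p_av_at.
    have n10 : 0 < (n.-1)%:R :> R by rewrite ltr0n; case: (n) n2 => [|[]].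
    rewrite mulrC ler_pdivrMr// => /le_trans; apply.
    rewrite -(@mul_div_powR _ a C2 beta x 1)// ?powRr1 ?(ltW a0)//; last first.
      by rewrite /x; ring.
    rewrite mulrC ler_wpM2r// ?ler_nat ?leq_pred//.
    by rewrite divr_ge0 ?powR_ge0 ?(ltW C20).
  pose A u := [set y | L * N <= #|random_graph (X n) y :&: J u|%SET%:R].
  have mA u : measurable (A u).
    exact: (measurable_graph_event (X n)
      [set H | L * N <= #|H :&: J u|%SET%:R]).
  pose B := \bigcup_(u in [set: 'I_n]) A u.
  have mB : measurable B by exact: fin_bigcup_measurable.
  apply: (@E_good_prob _ _ _ _ _ (X n) (w n) (fun _ u => u : nat) s M (L * N)
    _ _ _ _ B) => //; try exact: HM.
  + by move=> _; exact: val_inj.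
  + by rewrite (le_trans L1)// ler_peMr// (le_trans ler01).
  + rewrite mulrA ler_wpM2r ?(ltW N0)//; rewrite /C; lra.
  + by apply: div_powR_le => //; rewrite -/c /C; lra.
  + have PA u : (P n (A u) <= (expR (- (kappa + 1) * N))%:E)%E.
      apply: le_trans (edge_count_tail (L * N) (hXindep n) (JK u) (hX n)) _.
      rewrite lee_fin ler_expR -/e1.
      have := ler_wpM2l e10 (sumJ u); rewrite /L; lra.
    have BA y : B y -> exists2 u, u \in [set: 'I_n]%SET & A u y.
      by move=> [u _ Au]; exists u; rewrite ?inE.
    apply: (le_trans (probability_le_sum (P n) mA mB BA)).
    apply: (@le_trans _ _
        (\sum_(u in [set: 'I_n]%SET) (expR (- (kappa + 1) * N))%:E)%E).
      exact: lee_sum.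
    rewrite sumEFin lee_fin sumr_const cardsT card_ord -[leLHS]mulr_natl.
    rewrite [X in X * _](_ : _ = expR (ln a)); last by rewrite lnK.
    rewrite -expRD ler_expR -/a -/x -/N.
    have := ln_le_powR a1 x0; rewrite -/N -/kappa.
    have : C^-1 * N <= N.
      by rewrite ler_piMl ?(ltW N0)// invf_le1 /C; lra.
    lra.
  + move=> y By u; apply: (@le_trans _ _ #|random_graph (X n) y :&: J u|%SET%:R).
      rewrite ler_nat -(card_imset _ (edge_inj (u := u))).
      apply/subset_leq_card/fintype.subsetP => e /imsetP[v + ->].
      rewrite inE => /andP[uvG _]; rewrite finset.in_setI uvG imset_f// inE.
      by move: uvG; rewrite inE edge_K eq_sym => /andP[].
    apply/ltW; rewrite ltNge; apply/negP => Au.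
    by apply: By; exists u.
- move=> C1 C2 beta _ C20 /andP[sbeta beta1] hav gamma /andP[gamma0 hgamma].
  have s0 : 0 < s%:R :> R by rewrite ltr0n.
  have sb : 2 < s%:R * beta by move: sbeta; rewrite ltr_pdivrMr// mulrC.
  have sg : s%:R * gamma < s%:R * (beta / 2) - 1.
    by have := hgamma; rewrite -(ltr_pM2l s0) mulrBr mul1r divff ?gt_eqF.
  pose x := 1 - gamma; have x0 : 0 < x.
    have : 0 < 1 / s%:R :> R by rewrite divr_gt0.
    rewrite /x; lra.
  pose L := e1 * C2 + 1.
  have L1 : 1 <= L by rewrite lerDr mulr_ge0 ?(ltW C20).
  (* As [L2 >= 1], [2 * L * E <= L2 * N ^+ 2 <= (L2 * N) ^+ 2], so no square root is needed. *)
  pose L2 := 2 * L; have L21 : 1 <= L2 by rewrite /L2; lra.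
  pose C := 1 + (2 * M + 7) * L2 + c.
  have ML0 : 0 <= (2 * M + 7) * L2.
    by apply: mulr_ge0; lra.
  exists C; first by rewrite ltr_pwDl// ltr_pwDl.
  move=> n n2; pose a : R := n%:R.
  have a1 : 1 <= a by rewrite ler1n (leq_trans _ n2).
  have a0 : 0 < a by exact: lt_le_trans a1.
  pose N := a `^ x; have N1 : 1 <= N by rewrite one_le_powR// ltW.
  have N0 : 0 < N by exact: lt_le_trans N1.
  pose E := a `^ (2 - beta).
  have E0 : 0 < E by exact: powR_gt0.
  (* The exponents compare as [2 - beta <= 2 * (1 - gamma)], because [gamma < beta / 2]. *)
  have EN : E <= N ^+ 2.
    rewrite /E /N -powR_mulrn ?powR_ge0// -powRrM ler_powR// /x.
    have : 0 < 1 / s%:R :> R by rewrite divr_gt0.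
    lra.
  have sumK : \sum_(e in K n) p n e <= C2 * E.
    have /andP[_] := hav n n2; rewrite /p_av.
    have n10 : 0 < 'C(n, 2)%:R :> R by rewrite ltr0n bin_gt0.
    rewrite mulrC ler_pdivrMr// => /le_trans; apply.
    rewrite -(@mul_div_powR _ a C2 beta (2 - beta) 2%:R)//; last by ring.
    rewrite mulrC ler_wpM2r//.
      by rewrite divr_ge0 ?powR_ge0 ?(ltW C20).
    rewrite powR_mulrn ?(ltW a0)// /a -natrX ler_nat bin2 -mulnn.
    rewrite -divn2 (leq_trans (leq_div _ _))// leq_mul2l leq_pred orbT//.
  pose B := [set y | L * E <= #|random_graph (X n) y :&: K n|%SET%:R].
  have mB : measurable B.
    exact: (measurable_graph_event (X n)
      [set H | L * E <= #|H :&: K n|%SET%:R]).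
  apply: (@E_good_prob _ _ _ _ _ (X n) (w n) degree_rank s M (L2 * N)
    _ _ _ _ B) => //; try exact: HM.
  + by move=> H; exact: degree_rank_inj.
  + by rewrite (le_trans L21)// ler_peMr// (le_trans ler01).
  + rewrite mulrA ler_wpM2r ?(ltW N0)//; rewrite /C; lra.
  + apply: div_powR_le => //; first by rewrite -/c /C; lra.
    (* Required is [beta <= s * (1 - gamma) - 1]; by [sg] the right side exceeds
       [s - s * beta / 2 > s / 2 > 1 > beta]. *)
    have s2 : 2 < s%:R :> R.
      by rewrite (lt_trans sb)// -[ltRHS]mulr1 ltr_pM2l.
    have : s%:R * beta < s%:R by rewrite -[ltRHS]mulr1 ltr_pM2l.
    rewrite /x; lra.
  + apply: le_trans (edge_count_tail (L * E) (hXindep n) (subxx _) (hX n)) _.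
    rewrite lee_fin ler_expR -/e1.
    have := ler_wpM2l e10 sumK.
    have : C^-1 * E <= E.
      by rewrite ler_piMl ?(ltW E0)// invf_le1 /C; lra.
    rewrite -/a -/E /L; lra.
  + move=> y By u; set H := random_graph (X n) y.
    have HK : H \subset K n.
      by apply/fintype.subsetP => e; rewrite inE => /andP[].
    have HE : #|H|%:R <= L * E.
      apply/ltW; rewrite ltNge; apply/negP => HE; apply: By.
      by rewrite /B/= (finset.setIidPl HK).
    have := card_back_degree_rank u HK; rewrite -(ler_nat R) natrX -mul2n natrM.
    have L20 : 0 <= L2 by exact: le_trans L21.
    have LN0 : 0 <= L2 * N by exact: mulr_ge0 L20 (ltW N0).
    move=> bH; rewrite -ler_sqr ?nnegrE//.
    rewrite (le_trans bH)// exprMn.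
    apply: (@le_trans _ _ (L2 * E)); first by rewrite /L2 -mulrA ler_wpM2l.
    rewrite ler_pM ?(ltW E0)//.
    by rewrite expr2 ler_peMr.
Qed.
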